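(* Let $p=\big((x_1,y_1),(x_2,y_2)\big)$ be a pair of points of $(0,1)^2$ with $x_1<x_2$ and $y_2<y_1$, and let $T=Z_p$ be the zipper map of parameter $p$. Assume that $T$ is hypersensitive, i.e. $\lambda_{\min}:=\min\big(\frac{y_1}{x_1},\frac{y_1-y_2}{x_2-x_1},\frac{1-y_2}{1-x_2}\big)>1$, and assume moreover that at least one of the following holds: (1) $x_1+x_2=y_1+y_2=1$; or (2) $(y_1,y_2)$ lies in $B=\{(y_1,y_2)\in(0,1)^2 \mid y_1^2>y_2 \text{ and } y_1>(2-y_2)y_2\}$. Then $T$ admits horseshoes of all orders: for every positive integer $k$ there exist nondegenerate compact sub-intervals $I_1,\dots,I_k$ of $[0,1]$ with pairwise disjoint interiors such that $T(I_i)\supset I_j$ for all $i,j\in\{1,\dots,k\}$.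
   Context: Let $\mathscr{C}^0_0$ be the set of continuous maps $f:[0,1]\to[0,1]$ with $f(0)=0$ and $f(1)=1$, with the uniform distance. For $p=\big((x_1,y_1),(x_2,y_2)\big)$ with both points in $(0,1)^2$, $x_1<x_2$, $y_2<y_1$, let $\Phi_p:\mathscr{C}^0_0\to\mathscr{C}^0_0$ be defined by: $\Phi_pf(x)=y_1 f\big(\frac{x}{x_1}\big)$ if $x\in[0,x_1]$; $\Phi_pf(x)=y_1-(y_1-y_2)f\big(\frac{x-x_1}{x_2-x_1}\big)$ if $x\in[x_1,x_2]$; $\Phi_pf(x)=y_2+(1-y_2)f\big(\frac{x-x_2}{1-x_2}\big)$ if $x\in[x_2,1]$. The map $\Phi_p$ is a contraction in the uniform norm of ratio $\max(y_1,y_1-y_2,1-y_2)<1$; the zipper map $Z_p\in\mathscr{C}^0_0$ of parameter $p$ is its unique fixed point. *)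

(* Defs.v *)
(* MathComp-Analysis, over an arbitrary [R : realType]. *)
From HB Require Import structures.
From mathcomp Require Import all_boot all_order all_algebra.
From mathcomp Require Import all_classical all_reals all_analysis.

Set Implicit Arguments.
Unset Strict Implicit.
Unset Printing Implicit Defensive.

Import Order.TTheory GRing.Theory Num.Theory.
Import numFieldNormedType.Exports.

Local Open Scope classical_set_scope.
Local Open Scope ring_scope.

(* A map of [0,1] is represented by a total function [R -> R]; its values
   outside [0,1] are irrelevant, and no definition below depends on them. *)
Definition C00 (R : realType) : set (R -> R) :=
  [set f : R -> R | [/\ set_fun `[0, 1] `[0, 1] f,
                     {within `[0, 1], continuous f},
                     f 0 = 0 & f 1 = 1]].

(* [p = ((x1, y1), (x2, y2))]. *)
Definition zipper_param (R : realType) : set ((R * R) * (R * R)) :=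
  [set p | [/\ 0 < p.1.1 < 1, 0 < p.1.2 < 1, 0 < p.2.1 < 1 & 0 < p.2.2 < 1]
           /\ p.1.1 < p.2.1 /\ p.2.2 < p.1.2].

(* The clauses agree at [x1] and [x2] as soon as [f 0 = 0] and [f 1 = 1]. *)
Definition zipper_op (R : realType) (p : (R * R) * (R * R)) (f : R -> R)
    (x : R) : R :=
  let: ((x1, y1), (x2, y2)) := p in
  if x <= x1 then y1 * f (x / x1)
  else if x <= x2 then y1 - (y1 - y2) * f ((x - x1) / (x2 - x1))
  else y2 + (1 - y2) * f ((x - x2) / (1 - x2)).

(* [zipper_op p] is a contraction of [C00] for the uniform distance on [0,1]
   when [p] is a zipper parameter, so this determines [T] uniquely on [0,1]. *)
Definition is_zipper_map (R : realType) (p : (R * R) * (R * R))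
    (T : R -> R) : Prop :=
  C00 T /\ {in `[0, 1], forall x, zipper_op p T x = T x}.

Definition lambda_min (R : realType) (p : (R * R) * (R * R)) : R :=
  let: ((x1, y1), (x2, y2)) := p in
  Num.min (y1 / x1) (Num.min ((y1 - y2) / (x2 - x1)) ((1 - y2) / (1 - x2))).

Definition hypersensitive (R : realType) (p : (R * R) * (R * R)) : Prop :=
  1 < lambda_min p.

Definition regionB (R : realType) : set (R * R) :=
  [set y | [/\ 0 < y.1 < 1, 0 < y.2 < 1,
               y.1 ^+ 2 > y.2 & y.1 > (2 - y.2) * y.2]].

Definition nondegenerate_compact_subinterval (R : realType) (J : set R) : Prop :=
  exists a b : R, [/\ 0 <= a, a < b, b <= 1 & J = `[a, b]%classic].

Definition has_horseshoe (R : realType) (T : R -> R) (k : nat) : Prop :=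
  exists I : 'I_k -> set R,
    [/\ forall i, nondegenerate_compact_subinterval (I i),
        forall i j, i != j -> (I i)° `&` (I j)° = set0
      & forall i j, I j `<=` T @` I i].

(* Main.v *)
(* Hypersensitivity makes the small affine copies of the graph much higher than
   wide, so that all points of the window under such a copy are nearly at the same
   level. It thus suffices to find arbitrarily small windows [J] containing [k]
   non-overlapping intervals whose images extend beyond a common level of [J] by a
   margin comparable to the height of the copy over [J].

   In region B, first zoom into copies crossing the diagonal, using only the first
   and third laps so that all copies are decreasing. If the level is near the top
   (resp. bottom) of the copy, iterate the first (resp. third) lap: the
   inequalities of region B say that the level cannot jump over the zone
   [[y2, y1]], where it is crossed by all three laps. Once there, keep the third
   lap as one of the intervals, descend into the first one and start again. *)
Require Import Defs.
From HB Require Import structures.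
From mathcomp Require Import all_boot all_order all_algebra.
From mathcomp Require Import all_classical all_reals all_analysis.
From mathcomp Require Import ring lra.

Set Implicit Arguments.
Unset Strict Implicit.
Unset Printing Implicit Defensive.

Import Order.TTheory GRing.Theory Num.Theory.
Import numFieldNormedType.Exports.

Local Open Scope classical_set_scope.
Local Open Scope ring_scope.

(** * Intermediate values and a criterion for horseshoes *)

Lemma expr_lt_eventually (R : realType) (q e : R) :
  0 <= q < 1 -> 0 < e -> exists n : nat, q ^+ n < e.
Proof.
move=> /andP[q0 q1] e0.
have : `|q| < 1 by rewrite ger0_norm.
move=> /cvg_expr /cvgrPdist_lt /(_ e e0) [n _ /(_ n (leqnn n))].
by rewrite /= sub0r normrN ger0_norm ?exprn_ge0 // => h; exists n.
Qed.

Lemma subitv_covers (R : realType) (T : R -> R) (p q y : R) :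
  {within `[0, 1], continuous T} -> 0 <= p -> p <= q -> q <= 1 ->
  (T p <= y <= T q) || (T q <= y <= T p) ->
  exists2 x, p <= x <= q & T x = y.
Proof.
move=> cT p0 pq q1 Hy.
have cpq : {within `[p, q], continuous T}.
  apply: continuous_subspaceW cT => x /=.
  rewrite !in_itv /= => /andP[px xq].
  by rewrite (le_trans p0 px) (le_trans xq q1).
have [|x] := @IVT R T p q y pq cpq.
  rewrite ge_min le_max.
  by case/orP: Hy => /andP[-> ->]; rewrite ?orbT.
by rewrite in_itv /= => ? <-; exists x.
Qed.

(** The window [[A, B]] contains all the intervals, and the image of each covers it by intermediate
    values. The order in the second condition is left free, since the intervals are listed from left
    to right in one case and from right to left in the other. *)
Lemma has_horseshoe_laps (R : realType) (T : R -> R) (k : nat) (A B : R)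
    (p q : nat -> R) :
  {within `[0, 1], continuous T} -> 0 <= A -> B <= 1 ->
  (forall i, (i < k)%N -> [/\ A <= p i, p i < q i & q i <= B]) ->
  (forall i j, (i < j < k)%N -> q i <= p j \/ q j <= p i) ->
  (forall i, (i < k)%N ->
     T (p i) <= A /\ B <= T (q i) \/ T (q i) <= A /\ B <= T (p i)) ->
  has_horseshoe T k.
Proof.
move=> cT A0 B1 Hpq Hd HT.
exists (fun i : 'I_k => `[p i, q i]%classic); split.
- move=> i; have [Ap pq qB] := Hpq i (ltn_ord i).
  by exists (p i), (q i); split => //; [apply: le_trans Ap | apply: le_trans B1].
- have disj (i j : 'I_k) : (i < j)%N ->
      (`[p i, q i]%classic)° `&` (`[p j, q j]%classic)° = set0.
    move=> ij; rewrite -subset0 => x; rewrite !interior_itv_bnd => -[] /=.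
    rewrite !in_itv /= => /andP[h1 h2] /andP[h3 h4].
    have [||] := Hd i j; rewrite ?ij ?ltn_ord //; lra.
  move=> i j; rewrite neq_ltn => /orP[ij|ji]; first exact: disj.
  by rewrite setIC; apply: disj.
- move=> i j y /=; rewrite in_itv /= => /andP[h1 h2].
  have [Ap pq qB] := Hpq i (ltn_ord i).
  have [Ap' pq' qB'] := Hpq j (ltn_ord j).
  have [|||//|x xpq <-] := @subitv_covers R T (p i) (q i) y cT _ _ _.
  + lra.
  + lra.
  + lra.
  + by case: (HT i (ltn_ord i)) => -[t1 t2]; apply/orP; [left|right]; lra.
  + by exists x => //=; rewrite in_itv.
Qed.

(** * Self-affinity of the zipper map and decreasing copies of its graph *)

(** The fixed-point equation in the coordinate [z] of each lap, free of divisions and case tests. *)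
Definition self_affine (R : realType) (x1 y1 x2 y2 : R) (T : R -> R) : Prop :=
  forall z, 0 <= z <= 1 ->
    [/\ T (x1 * z) = y1 * T z,
        T (x1 + (x2 - x1) * z) = y1 - (y1 - y2) * T z
      & T (x2 + (1 - x2) * z) = y2 + (1 - y2) * T z].

Lemma zipper_self_affine (R : realType) (x1 y1 x2 y2 : R) (T : R -> R) :
  zipper_param ((x1, y1), (x2, y2)) ->
  is_zipper_map ((x1, y1), (x2, y2)) T ->
  self_affine x1 y1 x2 y2 T.
Proof.
move=> [[/= /andP[x10 x11] _ /andP[x20 x21] _] [x12 _]].
move=> [[_ _ T0 T1] Teq] z /andP[z0 z1].
have b1 : 0 <= x1 * z by rewrite mulr_ge0 // ltW.
have b1' : x1 * z <= x1 by rewrite ler_piMr // ltW.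
have b2 : 0 <= (x2 - x1) * z by rewrite mulr_ge0 // subr_ge0 ltW.
have b2' : (x2 - x1) * z <= x2 - x1 by rewrite ler_piMr // subr_ge0 ltW.
have b3 : 0 <= (1 - x2) * z by rewrite mulr_ge0 // subr_ge0 ltW.
have b3' : (1 - x2) * z <= 1 - x2 by rewrite ler_piMr // subr_ge0 ltW.
have n1 : x1 != 0 by rewrite gt_eqF.
have n2 : x2 - x1 != 0 by rewrite gt_eqF // subr_gt0.
have n3 : 1 - x2 != 0 by rewrite gt_eqF // subr_gt0.
split.
- rewrite -[LHS]Teq /=; last by rewrite in_itv /=; apply/andP; split; lra.
  by rewrite b1' mulrAC divff // mul1r.
- rewrite -[LHS]Teq /=; last by rewrite in_itv /=; apply/andP; split; lra.
  (* At [z = 0] the test selects the clause of the preceding lap; the values of [T] at 0 and 1 make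
     both agree. *)
  case: ifPn => [h|_].
    have hz : (x2 - x1) * z = 0 by lra.
    have -> : z = 0 by move/eqP: hz; rewrite mulf_eq0 (negPf n2) => /eqP.
    by rewrite mulr0 addr0 divff // T0 T1 mulr0 mulr1 subr0.
  case: ifPn => [_|]; last by move/negP; case; lra.
  by rewrite addrAC subrr add0r mulrAC divff // mul1r.
- rewrite -[LHS]Teq /=; last by rewrite in_itv /=; apply/andP; split; lra.
  case: ifPn => [h|_]; first by lra.
  case: ifPn => [h|_].
    have hz : (1 - x2) * z = 0 by lra.
    have -> : z = 0 by move/eqP: hz; rewrite mulf_eq0 (negPf n3) => /eqP.
    rewrite mulr0 addr0 divff // T0 T1; ring.
  by rewrite addrAC subrr add0r mulrAC divff // mul1r.
Qed.

(* The graph of [T] over [[a, a + L]] is the image of the whole graph under an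
   affine map reversing the vertical direction. *)
Definition dec_copy (R : realType) (T : R -> R) (a L H tau : R) : Prop :=
  [/\ 0 <= a, a + L <= 1, 0 < L, 0 < H
    & forall z, 0 <= z <= 1 -> T (a + L * z) = tau - H * T z].

(** The affine map of the first lap preserves the vertical direction, so the copy stays reversed;
    its left end [a] and top [tau] are kept. *)
Lemma dec_copy_lap1 (R : realType) (x1 y1 x2 y2 : R) (T : R -> R)
    (a L H tau : R) :
  0 < x1 < 1 -> 0 < y1 -> self_affine x1 y1 x2 y2 T ->
  dec_copy T a L H tau -> dec_copy T a (L * x1) (H * y1) tau.
Proof.
move=> /andP[x0 x11] y0 sT [a0 aL L0 H0 Tc].
have Lx : L * x1 <= L by rewrite ler_piMr // ltW.
split; [lra|lra|exact: mulr_gt0|exact: mulr_gt0|] => z /[dup] zb /andP[z0 z1].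
have [T1 _ _] := sT z zb.
have u0 : 0 <= x1 * z by rewrite mulr_ge0 // ltW.
have u1 : x1 * z <= 1 by rewrite mulr_ile1 // ltW.
by rewrite -mulrA Tc ?u0 // T1 mulrA.
Qed.

(** Here the right end [a + L] and the bottom [tau - H] are kept. *)
Lemma dec_copy_lap3 (R : realType) (x1 y1 x2 y2 : R) (T : R -> R)
    (a L H tau : R) :
  0 < x2 < 1 -> y2 < 1 -> self_affine x1 y1 x2 y2 T ->
  dec_copy T a L H tau ->
  dec_copy T (a + L * x2) (L * (1 - x2)) (H * (1 - y2)) (tau - H * y2).
Proof.
move=> /andP[x0 x21] y21 sT [a0 aL L0 H0 Tc].
have Lx : 0 < L * x2 by rewrite mulr_gt0.
split; [lra|lra|apply: mulr_gt0; lra|apply: mulr_gt0; lra|].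
move=> z /[dup] zb /andP[z0 z1].
have [_ _ T3] := sT z zb.
have u0 : 0 <= (1 - x2) * z by rewrite mulr_ge0 // subr_ge0 ltW.
have u1 : (1 - x2) * z <= 1 - x2 by rewrite ler_piMr // subr_ge0 ltW.
have -> : a + L * x2 + L * (1 - x2) * z = a + L * (x2 + (1 - x2) * z) by ring.
rewrite Tc; last by apply/andP; split; lra.
rewrite T3; ring.
Qed.

(* If the graph over the end of the first lap is already below the diagonal, the
   first lap crosses it; otherwise expansion of the second lap puts the start of
   the third one above the diagonal. *)
Lemma crossing_copy (R : realType) (x1 y1 x2 y2 l : R) (T : R -> R) (n : nat) :
  0 < x1 < 1 -> 0 < y1 -> 0 < x2 < 1 -> y2 < 1 -> x1 < x2 -> 1 < l ->
  l * x1 <= y1 -> l * (x2 - x1) <= y1 - y2 -> l * (1 - x2) <= 1 - y2 ->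
  self_affine x1 y1 x2 y2 T ->
  exists a L H tau, [/\ dec_copy T a L H tau, a < tau, tau - H < a + L
                      & l ^+ n * L <= H].
Proof.
move=> hx1 hy1 hx2 hy2 x12 l1 e1 e2 e3 sT.
have l0 : 0 < l by apply: lt_trans l1.
have /andP[x10 x11] := hx1; have /andP[x20 x21] := hx2.
have g1 : x1 < l * x1 by rewrite ltr_pMl.
have g2 : x2 - x1 < l * (x2 - x1) by rewrite ltr_pMl // subr_gt0.
have g3 : 1 - x2 < l * (1 - x2) by rewrite ltr_pMl // subr_gt0.
elim: n => [|n [a [L [H [tau [C Ca Cb CL]]]]]].
  (* The middle lap is the initial copy: expansion of the outer laps gives [x1 < y1] and
     [y2 < x2]. *)
  exists x1, (x2 - x1), (y1 - y2), y1; split; [|lra|lra|rewrite expr0; lra].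
  split; [lra|lra|lra|lra|] => z zb.
  by have [_ -> _] := sT z zb.
have [a0 aL L0 H0 Tc] := C.
have LH : L <= H.
  by apply: le_trans CL; rewrite ler_peMl ?exprn_ege1 // ltW.
(* Each descent multiplies [H / L] by at least [l]. *)
have grow x y : 0 < x -> l * x <= y -> l ^+ n.+1 * (L * x) <= H * y.
  move=> x0 xy; rewrite exprS.
  have -> : l * l ^+ n * (L * x) = (l ^+ n * L) * (l * x) by ring.
  by apply: ler_pM => //; rewrite mulr_ge0 ?exprn_ge0 // ltW.
have [h|h] := ltP (tau - H * y1) (a + L * x1).
  exists a, (L * x1), (H * y1), tau; split => //; last exact: grow.
  exact: dec_copy_lap1 sT C.
exists (a + L * x2), (L * (1 - x2)), (H * (1 - y2)), (tau - H * y2); split.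
- exact: dec_copy_lap3 sT C.
- have : L * (x2 - x1) < H * (y1 - y2).
    have : L * (x2 - x1) < L * (y1 - y2) by rewrite ltr_pM2l //; lra.
    by move/lt_le_trans; apply; rewrite ler_wpM2r //; lra.
  lra.
- lra.
- by apply: grow => //; lra.
Qed.

(** * Levels central in a copy, and the laps crossing them *)

(* [c] stays away from the images of the two turning points of the copy, hence
   each of its three laps crosses the level [c] with margin [d * H]. *)
Definition central_level (R : realType) (y1 y2 d H tau c : R) : Prop :=
  (y2 + d) * H <= tau - c <= (y1 - d) * H.

(* Iterating the first lap keeps [a] and [tau] and multiplies [H] by [y1] each
   time; since [y2 + d <= (y1 - d) * y1], it cannot jump over the central zone. *)
Lemma central_below (R : realType) (x1 y1 x2 y2 d : R) (T : R -> R)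
    (a L H tau c : R) :
  0 < x1 < 1 -> 0 < y1 < 1 -> 0 < y2 -> 0 < d -> x1 <= y1 ->
  y2 + d <= (y1 - d) * y1 -> self_affine x1 y1 x2 y2 T ->
  dec_copy T a L H tau -> c < tau -> tau - c <= (y1 - d) * H ->
  exists L' H', [/\ dec_copy T a L' H' tau, L' <= L, L' * H <= L * H',
                    tau - c <= H' & central_level y1 y2 d H' tau c].
Proof.
move=> hx1 /[dup] /andP[y10 y11] hy1 y20 d0 xy1 hd sT C ct cu.
(* [m] bounds the number of descents: at [m = 0] the inequality says that [tau - c] exceeds
   [(y2 + d) * H]. *)
have [m] : exists m, y1 ^+ m < (tau - c) / ((y2 + d) * H).
  have [_ _ _ H0 _] := C.
  apply: expr_lt_eventually; first by rewrite ltW.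
  by rewrite divr_gt0 ?subr_gt0 // mulr_gt0 // addr_gt0.
have /andP[x10 x11] := hx1.
elim: m L H C cu => [|m IH] L H C cu; have [a0 aL L0 H0 _] := C;
  have D0 : 0 < (y2 + d) * H by [rewrite mulr_gt0 // addr_gt0].
all: rewrite ltr_pdivlMr //.
all: have [h|h] := leP ((y2 + d) * H) (tau - c);
  first by move=> _; exists L, H; split => //; [nra|apply/andP].
  by rewrite mul1r; lra.
move=> hm.
have C' := dec_copy_lap1 hx1 y10 sT C.
have [||L' [H' [c1 c2 c3 c4 c5]]] := IH _ _ C'.
- have : (y2 + d) * H <= (y1 - d) * y1 * H by rewrite ler_pM2r.
  lra.
- rewrite ltr_pdivlMr; last by rewrite !mulr_gt0 // addr_gt0.
  by move: hm; rewrite exprSr; congr (_ < _); ring.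
have Lx : L * x1 <= L by rewrite ler_piMr // ltW.
have [_ _ L'0 H'0 _] := c1.
exists L', H'; split => //; first exact: le_trans Lx.
have : L' * (H * y1) <= L * y1 * H'.
  by apply: le_trans c3 _; rewrite ler_pM2r // ler_pM2l.
by rewrite mulrA [L * _ * _]mulrAC ler_pM2r.
Qed.

(** Mirror image of [central_below]: iterating the third lap keeps the right end and the bottom, and
    multiplies [H] by [1 - y2]. Measured from the bottom, the central zone goes from
    [(1 - y1 + d) * H] to [(1 - y2 - d) * H], too wide to be jumped over. *)
Lemma central_above (R : realType) (x1 y1 x2 y2 d : R) (T : R -> R)
    (a L H tau c : R) :
  0 < x2 < 1 -> 0 < y2 < 1 -> y1 < 1 -> 0 < d -> 1 - x2 <= 1 - y2 ->
  1 - y1 + d <= (1 - y2 - d) * (1 - y2) -> self_affine x1 y1 x2 y2 T ->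
  dec_copy T a L H tau -> tau - H < c -> c - (tau - H) <= (1 - y2 - d) * H ->
  exists a' L' H' tau',
    [/\ dec_copy T a' L' H' tau', a' + L' = a + L /\ L' <= L,
        L' * H <= L * H', c - (tau - H) <= H'
      & central_level y1 y2 d H' tau' c].
Proof.
move=> hx2 /[dup] /andP[y20 y21] hy2 y11 d0 xy2 hd sT C ct cu.
have dy : 0 < 1 - y1 + d by lra.
have [m] : exists m, (1 - y2) ^+ m < (c - (tau - H)) / ((1 - y1 + d) * H).
  have [_ _ _ H0 _] := C.
  apply: expr_lt_eventually; first by apply/andP; split; lra.
  by rewrite divr_gt0 ?subr_gt0 // mulr_gt0.
have /andP[x20 x21] := hx2.
have y2' : 0 < 1 - y2 by lra.
have x2' : 0 < 1 - x2 by lra.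
elim: m a L H tau C ct cu => [|m IH] a L H tau C ct cu;
  have [a0 aL L0 H0 _] := C; have D0 : 0 < (1 - y1 + d) * H by [rewrite mulr_gt0].
all: rewrite ltr_pdivlMr //.
all: have [h|h] := leP ((1 - y1 + d) * H) (c - (tau - H));
  first by move=> _; exists a, L, H, tau; split => //;
    [nra | apply/andP; split; lra].
  by rewrite mul1r; lra.
move=> hm.
have C' := dec_copy_lap3 hx2 y21 sT C.
have E : tau - H * y2 - H * (1 - y2) = tau - H by ring.
have [||| a' [L' [H' [tau' [c1 [c2 c2'] c3 c4 c5]]]]] := IH _ _ _ _ C'.
- by rewrite E.
- have : (1 - y1 + d) * H <= (1 - y2 - d) * (1 - y2) * H by rewrite ler_pM2r.
  lra.
- rewrite E ltr_pdivlMr; last by rewrite !mulr_gt0.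
  by move: hm; rewrite exprSr; congr (_ < _); ring.
have Lx : L * (1 - x2) <= L by rewrite ler_piMr // ltW //; lra.
have [_ _ L'0 H'0 _] := c1.
exists a', L', H', tau'; split => //.
- by split; [rewrite c2; ring | apply: le_trans Lx].
- have : L' * (H * (1 - y2)) <= L * (1 - y2) * H'.
    by apply: le_trans c3 _; rewrite ler_pM2r // ler_pM2l.
  by rewrite mulrA [L * _ * _]mulrAC ler_pM2r.
- by rewrite -E.
Qed.

(** Induction on [k]: the third lap is interval 0 and the others are found inside the first lap,
    hence the order from right to left. Each stage costs at most a factor [d] in height. *)
Lemma central_laps (R : realType) (x1 y1 x2 y2 d : R) (T : R -> R) (k : nat)
    (a L H tau c : R) :
  0 < x1 < 1 -> 0 < y1 < 1 -> 0 < x2 < 1 -> 0 < y2 < 1 -> x1 < x2 ->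
  x1 <= y1 -> 1 - x2 <= 1 - y2 -> 0 < d -> 2 * d <= y1 - y2 ->
  y2 + d <= (y1 - d) * y1 -> 1 - y1 + d <= (1 - y2 - d) * (1 - y2) ->
  T 0 = 0 -> T 1 = 1 -> self_affine x1 y1 x2 y2 T ->
  dec_copy T a L H tau -> central_level y1 y2 d H tau c ->
  exists p q : nat -> R,
    [/\ forall i, (i < k)%N -> [/\ a <= p i, p i < q i & q i <= a + L],
        forall i j, (i < j < k)%N -> q j <= p i
      & forall i, (i < k)%N ->
          T (q i) <= c - d ^+ k * H /\ c + d ^+ k * H <= T (p i)].
Proof.
move=> hx1 hy1 hx2 hy2 x12 xy1 xy2 d0 d2 hd1 hd2 T0 T1 sT.
have /andP[x10 x11] := hx1; have /andP[x20 x21] := hx2.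
have /andP[y10 y11] := hy1; have /andP[y20 y21] := hy2.
elim: k a L H tau => [|k IH] a L H tau C Cc.
  by exists (fun=> 0), (fun=> 0); split => // i j; rewrite ltn0 andbF.
have [a0 aL L0 H0 Tc] := C; have /andP[u1 u2] := Cc.
have C' := dec_copy_lap1 hx1 y10 sT C.
have dH : 0 < d * H by rewrite mulr_gt0.
have yH : 0 < y2 * H by rewrite mulr_gt0.
(* Centrality puts [c] at distance at least [d * H] from the top and the bottom of the first lap,
   which bounds [H'] below. As [2 * d <= y1 - y2], one of the two descents always applies. *)
have [a' [L' [H' [tau' [c1 c2 c3 c4 c5]]]]] : exists a' L' H' tau',
    [/\ dec_copy T a' L' H' tau', a <= a', a' + L' <= a + L * x1, d * H <= H'
      & central_level y1 y2 d H' tau' c].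
  have [h|h] := leP (tau - c) ((y1 - d) * (H * y1)).
    have [|L' [H' [c1 c2 c3 c4 c5]]] :=
      central_below hx1 hy1 y20 d0 xy1 hd1 sT C' (c := c) _ h; first by lra.
    by exists a, L', H', tau; split => //; lra.
  have [|| a' [L' [H' [tau' [c1 [c2 c2'] c3 c4 c5]]]]] :=
    central_above hx2 hy2 y11 d0 xy2 hd2 sT C' (c := c).
  - by lra.
  - have : 0 <= (y1 - y2 - 2 * d) * (H * y1) by rewrite mulr_ge0 ?mulr_ge0 //; lra.
    by lra.
  by exists a', L', H', tau'; split => //; lra.
have [p [q [i1 i2 i3]]] := IH _ _ _ _ c1 c5.
exists (fun i => if i is j.+1 then p j else a + L * x2).
exists (fun i => if i is j.+1 then q j else a + L * 1).
have Lx : 0 < L * x1 by rewrite mulr_gt0.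
have Lx2 : L * x1 < L * x2 by rewrite ltr_pM2l.
have Lx3 : L * x2 < L by rewrite -[ltRHS]mulr1 ltr_pM2l.
split.
- move=> [_|i]; first by split; lra.
  by rewrite ltnS => /i1[h1 h2 h3]; split; lra.
- move=> [|i] [|j] //.
    by rewrite /= ltnS => /i1[h1 h2 h3]; lra.
  by rewrite !ltnS => /i2.
- have dk : d ^+ k.+1 * H <= d * H.
    rewrite ler_pM2r // exprSr ler_piMl ?exprn_ile1 ?ltW //; lra.
  have dk' : d ^+ k.+1 * H <= d ^+ k * H'.
    by rewrite exprSr -mulrA ler_pM2l // exprn_gt0.
  move=> [_|i].
    have [|_ _ Tx2] := sT 0; first by rewrite lexx ler01.
    rewrite T0 !mulr0 !addr0 in Tx2.
    rewrite !Tc ?ler01 ?lexx ?(ltW x20) ?(ltW x21) // T1 Tx2; split; last by lra.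
    have : (y1 - d) * H <= (1 - d) * H by rewrite ler_pM2r //; lra.
    by lra.
  by rewrite ltnS => /i3[h1 h2]; split; lra.
Qed.

(** * Horseshoes in region B *)

Lemma horseshoe_regionB (R : realType) (x1 y1 x2 y2 l : R) (T : R -> R)
    (k : nat) :
  0 < x1 < 1 -> 0 < y1 < 1 -> 0 < x2 < 1 -> 0 < y2 < 1 -> x1 < x2 -> 1 < l ->
  l * x1 <= y1 -> l * (x2 - x1) <= y1 - y2 -> l * (1 - x2) <= 1 - y2 ->
  C00 T -> self_affine x1 y1 x2 y2 T -> regionB (y1, y2) ->
  has_horseshoe T k.
Proof.
move=> hx1 hy1 hx2 hy2 x12 l1 e1 e2 e3 [_ cT T0 T1] sT [_ _ /= B1 B2].
have /andP[x10 x11] := hx1; have /andP[x20 x21] := hx2.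
have /andP[y10 y11] := hy1; have /andP[y20 y21] := hy2.
have xy1 : x1 <= y1 by apply: le_trans e1; rewrite ler_peMl // ltW.
have xy2 : 1 - x2 <= 1 - y2.
  by apply: le_trans e3; rewrite ler_peMl ?ltW // subr_gt0.
(* Half the smaller slack in region B: expanded, the no-jump conditions lose [d * (1 + y1)] and
   [d * (2 - y2)], both at most [2 * d]. *)
pose d := Num.min (y1 ^+ 2 - y2) (y1 - (2 - y2) * y2) / 2.
have [d0 dle1 dle2] : [/\ 0 < d, 2 * d <= y1 ^+ 2 - y2
                        & 2 * d <= y1 - (2 - y2) * y2].
  have E : 2 * d = Num.min (y1 ^+ 2 - y2) (y1 - (2 - y2) * y2).
    by rewrite /d mulrC divfK // pnatr_eq0.
  split; first by rewrite divr_gt0 // lt_min !subr_gt0 B1 B2.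
    by rewrite E ge_min lexx.
  by rewrite E ge_min lexx orbT.
have dy1 : d * y1 < d by rewrite gtr_pMr.
have dy2 : 0 < d * y2 by rewrite mulr_gt0.
have yy : y1 ^+ 2 < y1 by rewrite expr2 gtr_pMr.
have hd1 : y2 + d <= (y1 - d) * y1 by lra.
have hd2 : 1 - y1 + d <= (1 - y2 - d) * (1 - y2) by lra.
have d2 : 2 * d < y1 - y2 by lra.
(* The first term fits the window into the margin of [central_laps]; the second allows the level to
   move from [a] to [a + L]. *)
pose e := Num.min (d ^+ k) (y1 - y2 - 2 * d).
have e0 : 0 < e by rewrite lt_min exprn_gt0 // subr_gt0.
have l0 : 0 < l by apply: lt_trans l1.
have [n hn] : exists n, l^-1 ^+ n < e.
  by apply: expr_lt_eventually; rewrite // invr_ge0 (ltW l0) invf_lt1.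
have [a [L [H [tau [C Ca Cb CL]]]]] :=
  crossing_copy n hx1 y10 hx2 y21 x12 l1 e1 e2 e3 sT.
have [a0 aL L0 H0 _] := C.
have LH : L <= e * H.
  have ln0 : 0 < l ^+ n by rewrite exprn_gt0.
  have : l^-1 ^+ n * H <= e * H by rewrite ler_pM2r // ltW.
  apply: le_trans; rewrite exprVn -(ler_pM2l ln0) mulrA divff ?gt_eqF //.
  by rewrite mul1r.
have [a' [L' [H' [tau' [c [C' LH' /andP[c1 c2] c3]]]]]] :
    exists a' L' H' tau' c, [/\ dec_copy T a' L' H' tau', L' <= e * H',
      a' <= c <= a' + L' & central_level y1 y2 d H' tau' c].
  have ratio L' H' : L' * H <= L * H' -> 0 < H' -> L' <= e * H'.
    move=> h H'0; rewrite -(ler_pM2r H0); apply: le_trans h _.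
    by rewrite mulrAC ler_pM2r.
  (* The level must stay in the shrinking window: first laps keep the left end, third laps the right
     end. *)
  have [h|h] := leP (tau - a) ((y1 - d) * H).
    have [L' [H' [c1 c2 c3 c4 c5]]] :=
      central_below hx1 hy1 y20 d0 xy1 hd1 sT C Ca h.
    have [_ _ L'0 H'0 _] := c1.
    exists a, L', H', tau, a; split => //; first exact: ratio.
    by apply/andP; split; lra.
  have [| a' [L' [H' [tau' [c1 [c2 c2'] c3 c4 c5]]]]] :=
    central_above hx2 hy2 y11 d0 xy2 hd2 sT C Cb.
    have : e * H <= (y1 - y2 - 2 * d) * H.
      by rewrite ler_pM2r // ge_min lexx orbT.
    by lra.
  have [_ _ L'0 H'0 _] := c1.
  exists a', L', H', tau', (a + L); split => //; first exact: ratio.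
  by apply/andP; split; lra.
have [p [q [i1 i2 i3]]] := central_laps k hx1 hy1 hx2 hy2 x12 xy1 xy2 d0 (ltW d2)
  hd1 hd2 T0 T1 sT C' c3.
have [a'0 aL' L'0 H'0 _] := C'.
have eH : e * H' <= d ^+ k * H' by rewrite ler_pM2r // ge_min lexx.
apply: (has_horseshoe_laps cT a'0 aL' i1) => i.
  by move=> j /i2; right.
by move=> /i3[h1 h2]; right; split; lra.
Qed.

(** * The symmetric case *)

(* In the symmetric case the middle lap gives an affine map of linear part
   [diag (s, - t)] fixing [(1/2, 1/2)] and sending the graph into itself, where
   [s = x2 - x1] and [t = y1 - y2]. Consecutive points of the orbit of [(0, 0)]
   bound the sought intervals. *)
Lemma horseshoe_symmetric (R : realType) (x1 y1 x2 y2 : R) (T : R -> R)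
    (k : nat) :
  x1 < x2 < 1 -> 0 < x1 -> 0 < y2 -> y1 < 1 -> x2 - x1 < y1 - y2 ->
  C00 T -> self_affine x1 y1 x2 y2 T -> x1 + x2 = 1 -> y1 + y2 = 1 ->
  has_horseshoe T k.
Proof.
move=> /andP[x12 x21] x10 y20 y11 xy [_ cT T0 _] sT xs ys.
have [s s0 [s1 Es]] : exists2 s, 0 < s & s < 1 /\ x2 - x1 = s.
  by exists (x2 - x1); [lra|split; lra].
have [t st [t1 Et]] : exists2 t, s < t & t < 1 /\ y1 - y2 = t.
  by exists (y1 - y2); [lra|split; lra].
have t0 : 0 < t by apply: lt_trans st.
(* Abscissa of the [j]-th orbit point; [Tp] gives its ordinate. *)
pose p j := (1 - s ^+ j) / 2.
have sj j : 0 < s ^+ j <= 1 by rewrite exprn_gt0 // exprn_ile1 // ltW.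
have Tp j : T (p j) = (1 - (- t) ^+ j) / 2.
  elim: j => [|j IH]; first by rewrite /p !expr0 subrr !mul0r.
  have [|_ + _] := sT (p j).
    by have := sj j; rewrite /p => /andP[? ?]; apply/andP; split; lra.
  rewrite Es Et IH !exprS => h.
  have -> : p j.+1 = x1 + s * p j by rewrite /p exprS; lra.
  by rewrite h; lra.
(* The window [[p n, 1/2]] has width [s ^+ n / 2], while orbit points up to rank [n + k] lie at
   height at least [t ^+ (n + k) / 2] away from 1/2. *)
have [n hn] : exists n, (s / t) ^+ n < t ^+ k.
  apply: expr_lt_eventually; last exact: exprn_gt0.
  by rewrite divr_ge0 ?ltW // ltr_pdivrMr ?mul1r.
have {}hn : s ^+ n <= t ^+ (n + k).
  move: hn; rewrite expr_div_n ltr_pdivrMr ?exprn_gt0 // => /ltW.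
  by rewrite exprD mulrC.
have pS j : p j < p j.+1.
  have /andP[h _] := sj j.
  have : s * s ^+ j < s ^+ j by rewrite gtr_pMl.
  by rewrite /p exprS; lra.
have ple i j : (i <= j)%N -> p i <= p j.
  by move=> /subnK <-; elim: (j - i)%N => // m /le_trans; apply; apply/ltW/pS.
have ph j : p j <= 1 / 2 by have /andP[h _] := sj j; rewrite /p; lra.
apply: (@has_horseshoe_laps _ T k (p n) (1 / 2) (fun i => p (n + i)%N)
  (fun i => p (n + i).+1)) => //.
- by have /andP[_ h] := sj n; rewrite /p; lra.
- by lra.
- by move=> i _; split; [apply: ple; rewrite leq_addr|apply: pS|].
- by move=> i j /andP[ij _]; left; apply: ple; rewrite ltn_add2l.
- move=> i ik; rewrite !Tp.
  have tk j : (j <= n + k)%N -> s ^+ n <= t ^+ j.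
    by move=> jk; apply: le_trans hn _; rewrite ler_wiXn2l ?(ltW t0) ?(ltW t1).
  have h1 : s ^+ n <= t ^+ (n + i) by apply: tk; rewrite leq_add2l ltnW.
  have h2 : s ^+ n <= t ^+ (n + i).+1 by apply: tk; rewrite -addnS leq_add2l.
  have /andP[h3 _] := sj n.
  (* The parity of [n + i] decides which endpoint has its image above the window. *)
  rewrite ![(- t) ^+ _]exprNn [(-1) ^+ _.+1]exprS -signr_odd /p.
  by case: odd; rewrite /= ?expr0 ?expr1; [right|left]; lra.
Qed.

Theorem theorem1 (R : realType) (x1 y1 x2 y2 : R) (T : R -> R)
  (hp : zipper_param ((x1, y1), (x2, y2)))
  (hT : is_zipper_map ((x1, y1), (x2, y2)) T)
  (hyper : hypersensitive ((x1, y1), (x2, y2)))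
  (hcase : (x1 + x2 = 1 /\ y1 + y2 = 1) \/ regionB (y1, y2)) :
  forall k : nat, (0 < k)%N -> has_horseshoe T k.
Proof.
move=> k _.
have sT := zipper_self_affine hp hT.
have [CT _] := hT.
have [[/= hx1 hy1 hx2 hy2] [x12 y12]] := hp.
have [/andP[x10 x11] /andP[y10 y11]] := (hx1, hy1).
have [/andP[x20 x21] /andP[y20 y21]] := (hx2, hy2).
(* [lambda_min] itself serves as the common expansion factor. *)
have [e1 e2 e3] : let l := lambda_min ((x1, y1), (x2, y2)) in
    [/\ l * x1 <= y1, l * (x2 - x1) <= y1 - y2 & l * (1 - x2) <= 1 - y2].
  rewrite /lambda_min; split.
  - by rewrite -ler_pdivlMr // ge_min lexx.
  - by rewrite -ler_pdivlMr ?subr_gt0 // !ge_min lexx !orbT.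
  - by rewrite -ler_pdivlMr ?subr_gt0 // !ge_min lexx !orbT.
case: hcase => [[xs ys]|hB].
  apply: (horseshoe_symmetric _ _ x10 y20 y11 _ CT sT xs ys).
    by rewrite x12.
  by apply: lt_le_trans e2; rewrite ltr_pMl // subr_gt0.
exact: horseshoe_regionB hx1 hy1 hx2 hy2 x12 hyper e1 e2 e3 CT sT hB.
Qed.
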